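(* Let $(\mathcal{A},m)$ be a multiarrangement in $V=\mathbb{K}^\ell$ with a hyperplane $H_0\in\mathcal{A}$, and put $m_0=m(H_0)$. Assume $(\mathcal{A},m)$ has a good summand $\theta_0\in D(\mathcal{A},m)$ to $H_0$. Then $(t-m_0)$ divides $\chi(\mathcal{A},m;t)$.
   Context: Let $\mathbb{K}$ be a field and $S=\mathbb{K}[x_1,\dots,x_\ell]$. A multiarrangement $(\mathcal{A},m)$ is a finite set of linear hyperplanes $H=\ker\alpha_H$ of $\mathbb{K}^\ell$ with $m:\mathcal{A}\to\mathbb{Z}_{>0}$. For $p\ge1$, $D^p(\mathcal{A},m)$ is the graded $S$-module of alternating maps $\theta:S^p\to S$ that are $\mathbb{K}$-derivations in each argument with $\theta(\alpha_H,f_2,\dots,f_p)\in\alpha_H^{m(H)}S$ for all $H,f_i$; $D^0(\mathcal{A},m)=S$, and $D(\mathcal{A},m)=D^1(\mathcal{A},m)$. $\psi(\mathcal{A},m;x,t)=\sum_{p=0}^\ell\mathrm{Hilb}(D^p(\mathcal{A},m),x)(t(x-1)-1)^p$, which is a polynomial in $x,t$. The characteristic polynomial is $\chi(\mathcal{A},m;t)=(-1)^\ell\psi(\mathcal{A},m;1,t)$. A good summand to $H_0$ is $\theta_0\in D(\mathcal{A},m)$ with all $\theta_0(x_i)$ zero or homogeneous of degree $m(H_0)$, and $\theta_0(\alpha_{H_0})=\alpha_{H_0}^{m(H_0)}$. *)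

(* Defs.v *)
From HB Require Import structures.
From mathcomp Require Import all_boot all_order all_algebra.
From mathcomp Require Import mpoly.
Set Implicit Arguments. Unset Strict Implicit. Unset Printing Implicit Defensive.
Import Order.TTheory GRing.Theory Num.Theory.
Local Open Scope ring_scope.

Section MultiArr.
Variables (K : fieldType) (l : nat).
Local Notation S := {mpoly K[l]}.

Definition linform (a : 'I_l -> K) : S := \sum_(i < l) a i *: 'X_i.

Definition upd (p : nat) (f : 'I_p -> S) (i : 'I_p) (g : S) : 'I_p -> S :=
  fun j => if j == i then g else f j.

Definition multider (p : nat) (th : ('I_p -> S) -> S) : Prop :=
  forall (f : 'I_p -> S) (i : 'I_p),
    (forall (a : K) (g1 g2 : S),
        th (upd f i (a *: g1 + g2)) = a *: th (upd f i g1) + th (upd f i g2)) /\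
    (forall g1 g2 : S,
        th (upd f i (g1 * g2)) = g1 * th (upd f i g2) + g2 * th (upd f i g1)).

Definition alternating (p : nat) (th : ('I_p -> S) -> S) : Prop :=
  forall (f : 'I_p -> S) (i j : 'I_p), i != j -> f i = f j -> th f = 0.

(* A multiarrangement: n hyperplanes H_k = ker alpha_H with
   alpha_H = linform (alpha k), multiplicities m k. *)
Definition is_multiarr (n : nat) (alpha : 'I_n -> 'I_l -> K) (m : 'I_n -> nat) : Prop :=
  (forall k, exists j, alpha k j != 0) /\
  (forall k k', k != k' -> forall c : K, ~ (forall j, alpha k j = c * alpha k' j)) /\
  (forall k, (0 < m k)%N).

(* D^p(A,m): alternating multiderivations with theta(alpha_H, f2,..,fp) in
   alpha_H^{m(H)} S.  For p = 0 the (vacuous) condition gives D^0 = S. *)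
Definition Dp (n : nat) (alpha : 'I_n -> 'I_l -> K) (m : 'I_n -> nat)
    (p : nat) (th : ('I_p -> S) -> S) : Prop :=
  multider th /\ alternating th /\
  forall (Hp : (0 < p)%N) (k : 'I_n) (f : 'I_p -> S),
    f (Ordinal Hp) = linform (alpha k) ->
    exists q : S, th f = linform (alpha k) ^+ m k * q.

Definition homog_deg (p d : nat) (th : ('I_p -> S) -> S) : Prop :=
  forall ii : 'I_p -> 'I_l, th (fun j => 'X_(ii j)) \is d.-homog.

Definition linindep (p k : nat) (v : 'I_k -> ('I_p -> S) -> S) : Prop :=
  forall c : 'I_k -> K, (forall f, \sum_(i < k) c i *: v i f = 0) -> forall i, c i = 0.

Definition is_dim (p : nat) (P : (('I_p -> S) -> S) -> Prop) (N : nat) : Prop :=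
  (exists v : 'I_N -> ('I_p -> S) -> S, (forall i, P (v i)) /\ linindep v) /\
  (forall v : 'I_N.+1 -> ('I_p -> S) -> S, (forall i, P (v i)) -> ~ linindep v).

Definition is_hilb (n : nat) (alpha : 'I_n -> 'I_l -> K) (m : 'I_n -> nat)
    (h : nat -> nat -> nat) : Prop :=
  forall p d, (p <= l)%N -> is_dim (fun th : ('I_p -> S) -> S => Dp alpha m th /\ homog_deg d th) (h p d).

Definition good_summand (n : nat) (alpha : 'I_n -> 'I_l -> K) (m : 'I_n -> nat)
    (k0 : 'I_n) (th0 : ('I_1 -> S) -> S) : Prop :=
  Dp alpha m th0 /\
  (forall i : 'I_l, th0 (fun _ => 'X_i) \is (m k0).-homog) /\
  th0 (fun _ => linform (alpha k0)) = linform (alpha k0) ^+ m k0.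

End MultiArr.

(* psi(x,t) = sum_p Hilb(D^p,x) (t(x-1)-1)^p = sum_d psi_coef h d (t) x^d.
   Bivariate: outer variable x, inner variable t, over int. *)
Definition psi_factor : {poly {poly int}} :=
  ('X : {poly int})%:P * 'X - (('X : {poly int}) + 1)%:P.

Definition psi_coef (l : nat) (h : nat -> nat -> nat) (d : nat) : {poly int} :=
  \sum_(p < l.+1) \sum_(j < d.+1) (psi_factor ^+ p)`_(d - j) *+ h p j.

(* chi(t) = (-1)^l psi(1,t), where psi_coef h d = 0 for d >= N. *)
Definition chi_trunc (l : nat) (h : nat -> nat -> nat) (N : nat) : {poly int} :=
  (-1) ^+ l * \sum_(d < N) psi_coef l h d.

(* Main.v *)
(** Let alpha0 define H0 and m0 = m(H0). On D^p consider the contraction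
    th |-> th(alpha0, ...) / alpha0^m0, with kernel Z_p for p >= 1 and Z_0 = D^0.
    Exterior multiplication by the good summand th0 is a section of it, so
    D^(p+1) is the direct sum of Z_(p+1) and th0 ^ Z_p, while Z_l = 0 because
    D^(l+1) = 0. On Hilbert series, H_(p+1) = Z_(p+1) + x^m0 Z_p. Hence, with
    y = t (x - 1) - 1, the sum psi of the H_p y^p is a multiple of 1 + x^m0 y and
    vanishes at the root t = (1 - x^m0) / (x^m0 (1 - x)) of that factor, which is
    m0 at x = 1. Putting x = 1/u makes this root the polynomial u + ... + u^m0, so
    no denominators are needed. *)

Require Import Defs.
From HB Require Import structures.
From mathcomp Require Import all_boot all_order all_algebra all_fingroup.
From mathcomp Require Import mpoly zify ring.
From Stdlib Require Import Classical FunctionalExtensionality IndefiniteDescription.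
Set Implicit Arguments. Unset Strict Implicit. Unset Printing Implicit Defensive.
Import GRing.Theory.
Local Open Scope ring_scope.

(** * The specialisation of psi *)

Section Reversal.
Variable m0 : nat.

Definition revT : {poly int} := \sum_(i < m0) 'X^(i.+1).

(** With x = 1/u and t = [revT] the left side is u y, so this is y = - x^(-m0) cleared of
    denominators. The sum is geometric. *)
Lemma revT_factor : revT - (revT + 1) * 'X = - 'X^(m0.+1).
Proof.
suff H : revT * (1 - 'X) = 'X - 'X^(m0.+1).
  by rewrite mulrDl mul1r opprD addrA -mulrN -{1}[revT]mulr1 -mulrDr H addrAC subrr add0r.
rewrite /revT; elim: m0 => [|k IHk]; first by rewrite big_ord0 mul0r expr1 subrr.
by rewrite big_ord_recr /= mulrDl IHk (exprS _ k.+1); ring.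
Qed.

Lemma size_revT : (size revT <= m0.+1)%N.
Proof.
apply: leq_trans (size_sum _ _ _) _; apply/bigmax_leqP => i _.
by rewrite size_polyXn ltnS ltn_ord.
Qed.

Lemma horner_revT1 : revT.[1] = m0%:R.
Proof.
rewrite horner_sum (eq_bigr (fun=> 1)) => [|i _].
  by rewrite sumr_const card_ord.
by rewrite hornerXn expr1n.
Qed.

(** In the variable x, [psi_factor] is y = t x - (t + 1). This is the coefficient of x^e in y^p,
    made a polynomial in u by t = [revT]. *)
Definition revcoef (p e : nat) : {poly int} := (psi_factor ^+ p)`_e \Po revT.

Lemma revcoef0 e : revcoef 0 e = (e == 0)%:R.
Proof. by rewrite /revcoef expr0 coef1; case: eqP; rewrite (comp_polyC 1, comp_poly0). Qed.

Lemma revcoefS p e :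
  revcoef p.+1 e = (if e is e'.+1 then revcoef p e' else 0) * revT
                   - revcoef p e * (revT + 1).
Proof.
rewrite /revcoef exprSr /psi_factor mulrBr mulrA coefB coefMX !coefMC.
rewrite comp_polyB comp_polyM comp_polyD comp_polyX (comp_polyC 1).
case: e => [|e] /=; first by rewrite comp_poly0 mul0r.
by rewrite comp_polyM comp_polyX.
Qed.

(** Each factor y contributes a coefficient of degree at most m0 in u. The bound is uniform in e and
    confines truncation errors to low u-degrees. *)
Lemma size_revcoef p e : (size (revcoef p e) <= (m0 * p).+1)%N.
Proof.
elim: p e => [|p IHp] e; first by rewrite revcoef0; case: eqP; rewrite ?size_poly1 ?size_poly0.
have mulb (q r : {poly int}) : (size q <= (m0 * p).+1)%N -> (size r <= m0.+1)%N ->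
    (size (q * r)%R <= (m0 * p.+1).+1)%N.
  by move=> hq hr; apply: leq_trans (size_polyMleq _ _) _; lia.
rewrite revcoefS; apply: leq_trans (size_polyD _ _) _.
rewrite size_polyN geq_max; apply/andP; split.
  by apply: mulb size_revT; case: e => [|e]; rewrite ?size_poly0.
apply: mulb => //; apply: leq_trans (size_polyD _ _) _.
by rewrite size_poly1 geq_max size_revT.
Qed.

(* Under x = 1/u the substitution t := revT(u) sends t (x - 1) - 1 to - u^m0. *)
Lemma sum_revcoef p n : (p <= n)%N ->
  \sum_(e < n.+1) revcoef p e * 'X^(n - e) = (-1) ^+ p * 'X^(n + m0 * p).
Proof.
elim: p n => [|p IHp] n le_pn.
  rewrite big_ord_recl /= revcoef0 subn0 muln0 addn0 big1 ?addr0 // => i _.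
  by rewrite revcoef0 mul0r.
case: n le_pn => // n le_pn.
under eq_bigr => e _ do rewrite revcoefS mulrBl.
rewrite sumrB big_ord_recl /= 2!mul0r add0r.
under eq_bigr => e _ do rewrite /bump leq0n add1n subSS mulrAC.
rewrite -mulr_suml IHp //.
under eq_bigr => e _ do rewrite mulrAC.
rewrite -mulr_suml IHp ?leqW // addSn exprS -!mulrA -mulrBr exprS -mulrA.
(* Both sums carry u^(n + m0 p), and the cofactor is u y. *)
rewrite (_ : _ - _ = 'X^(n + m0 * p) * (revT - (revT + 1) * 'X)); last first.
  by rewrite mulrBr (mulrC _ 'X) !mulrA (mulrC 'X) -!mulrA (mulrC 'X).
rewrite revT_factor mulrN mulN1r mulrN -exprD.
by congr (- (_ * 'X^_)); lia.
Qed.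

(** If p <= M - 1 - j, the cut keeps all of y^p and [sum_revcoef] applies. Otherwise every term has
    u-degree below p + m0 p, hence below c, and both sides are 0. *)
Lemma coef_sum_revcoef p M j c : (j < M)%N -> (p + m0 * p < c)%N ->
  (\sum_(e < M - j) revcoef p e * 'X^(M.-1 - j - e))`_c
  = (-1) ^+ p * (c + j.+1 == M + m0 * p)%N%:R.
Proof.
move=> lt_jM lt_c.
have -> : (M - j = (M.-1 - j).+1)%N by lia.
have [le_p|lt_p] := leqP p (M.-1 - j).
  rewrite sum_revcoef // -[(-1) ^+ p](rmorph_sign polyC) coefCM coefXn.
  by congr (_ * (nat_of_bool _)%:R); lia.
rewrite (_ : (c + _ == _) = false) ?mulr0; last by lia.
rewrite coef_sum big1 // => e _; rewrite coefMXn; case: ltnP => // le_c.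
by rewrite nth_default //; apply: leq_trans (size_revcoef _ _) _; lia.
Qed.

End Reversal.

Lemma sum_triangle (V : nmodType) (A : nat -> nat -> V) (M : nat) :
  \sum_(d < M) \sum_(j < d.+1) A d j = \sum_(j < M) \sum_(e < M - j) A (j + e)%N j.
Proof.
elim: M => [|M IHM]; first by rewrite !big_ord0.
rewrite big_ord_recr /= {}IHM.
under [RHS]eq_bigr => j _.
  rewrite subSn ?big_ord_recr /= ?subnKC -1?ltnS //; over.
by rewrite big_split [X in X + _ = _]/= [X in _ = X + _]big_ord_recr /= subnn big_ord0 addr0.
Qed.

(* The contributions of the k p d telescope since 1 + x^m0 y is sent to 0. Cutting
   the series in x = 1/u at x^M only spoils low u-degrees, and padding the bound N to
   a large M shifts every coefficient of the sum above them. *)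
Lemma chi_trunc_root (l m0 N : nat) (h k : nat -> nat -> nat) :
  (forall d, h 0 d = k 0 d) ->
  (forall p d, (p < l)%N ->
     h p.+1 d = (k p.+1 d + if (m0 <= d)%N then k p (d - m0) else 0)%N) ->
  (forall d, k l d = 0%N) ->
  (forall d, (N <= d)%N -> psi_coef l h d = 0) ->
  (chi_trunc l h N).[m0%:R] = 0.
Proof.
move=> h0 hS kl psi0.
(* [Q M] is u^(M - 1) times the part of psi below x^M, at x = 1/u and t = [revT]. *)
pose Q M : {poly int} := \sum_(d < M) (psi_coef l h d \Po revT m0) * 'X^(M.-1 - d).
have QM M : (N <= M)%N -> Q M = Q N * 'X^(M - N).
  move=> le_NM; rewrite /Q.
  rewrite -(big_mkord xpredT (fun d => (psi_coef l h d \Po revT m0) * 'X^(M.-1 - d))).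
  rewrite (big_cat_nat _ le_NM) //= [X in _ + X]big_nat_cond [X in _ + X]big1 ?addr0.
    rewrite big_mkord mulr_suml; apply: eq_bigr => d _; rewrite -mulrA -exprD.
    by congr (_ * 'X^_); have := ltn_ord d; lia.
  by move=> d /andP[/andP[le_Nd _] _]; rewrite psi0 // comp_poly0 mul0r.
have QE M : Q M = \sum_(p < l.+1) \sum_(j < M)
    (\sum_(e < M - j) revcoef m0 p e * 'X^(M.-1 - j - e)) *+ h p j.
  rewrite /Q /psi_coef.
  under eq_bigr => d _ do rewrite raddf_sum /= mulr_suml.
  rewrite exchange_big /=; apply: eq_bigr => p _.
  under eq_bigr => d _ do rewrite raddf_sum /= mulr_suml.
  under eq_bigr => d _ do under eq_bigr => j _ do rewrite raddfMn /=.
  rewrite (sum_triangle (fun d j =>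
    ((psi_factor ^+ p)`_(d - j) \Po revT m0) *+ h p j * 'X^(M.-1 - d))).
  apply: eq_bigr => j _; rewrite -sumrMnl; apply: eq_bigr => e _.
  by rewrite addKn mulrnAl /revcoef subnDA.
(* At u = 1 one has x = 1 and [revT] = m0, so [Q N] takes the value psi(1, m0). *)
suff Q0 : Q N = 0.
  rewrite /chi_trunc hornerM; apply/eqP; rewrite mulf_eq0; apply/orP; right; apply/eqP.
  have := congr1 (fun q => q.[1]) Q0; rewrite /Q horner0 horner_sum => <-.
  rewrite horner_sum; apply: eq_bigr => d _.
  by rewrite hornerM horner_comp horner_revT1 hornerXn expr1n mulr1.
apply/polyP => c0; rewrite coef0.
(* With this padding c exceeds p + m0 p for every p <= l, as [coef_sum_revcoef] requires. *)
have [M defM] : exists M, M = (N + (l.+1 + m0 * l.+1))%N by eexists.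
have le_NM : (N <= M)%N by rewrite defM leq_addr.
pose c := (M - N + c0)%N.
have -> : (Q N)`_c0 = (Q M)`_c.
  by rewrite (QM M) // coefMXn /c ltnNge leq_addr /= addKn.
(* The equation c + j + 1 = M + m0 p has the one solution j = N + m0 p - c0 - 1; if that is
   negative, no j contributes. *)
pose shift (f : nat -> nat -> nat) p :=
  if (c0 < N + m0 * p)%N then f p (N + m0 * p - c0.+1)%N else 0%N.
have -> : (Q M)`_c = \sum_(p < l.+1) (-1) ^+ p * (shift h p)%:R.
  rewrite QE coef_sum; apply: eq_bigr => p _; have lt_pl := ltn_ord p.
  have le_m : (m0 * p <= m0 * l.+1)%N by rewrite leq_mul2l ltnW ?orbT.
  rewrite coef_sum.
  under eq_bigr => j _.
    rewrite coefMn coef_sum_revcoef //; last by rewrite /c; lia.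
    rewrite -mulrnAr -mulr_natr -natrM; over.
  rewrite -mulr_sumr -natr_sum; congr (_ * _%:R); rewrite /shift.
  case: ltnP => Hc; last first.
    by rewrite big1 // => j _; rewrite (_ : (_ == _) = false) //; apply/negbTE/eqP; rewrite /c; lia.
  have lt_jM : (N + m0 * p - c0.+1 < M)%N by lia.
  rewrite (bigD1 (Ordinal lt_jM)) //= big1 => [|j]; last first.
    rewrite -val_eqE /= => /eqP ne_j.
    by rewrite (_ : (_ == _) = false) //; apply/negbTE/eqP; rewrite /c; lia.
  by rewrite (_ : (_ == _) = true) ?mul1n ?addn0 //; apply/eqP; rewrite /c; lia.
(* The index in [shift] grows by m0 with each p, exactly the degree shift in [hS]. So [shift h p.+1]
   is [shift k p.+1 + shift k p], and the alternating sum telescopes. *)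
have tele p : (p <= l)%N ->
    \sum_(q < p.+1) (-1) ^+ q * (shift h q)%:R = (-1) ^+ p * (shift k p)%:R :> int.
  elim: p => [_|p IHp lt_pl]; first by rewrite big_ord_recr big_ord0 /= add0r /shift h0.
  rewrite big_ord_recr /= IHp 1?ltnW // exprS mulN1r !mulNr.
  have -> : shift h p.+1 = (shift k p.+1 + shift k p)%N.
    rewrite /shift; case: (ltnP c0 (N + m0 * p.+1)) => H1.
      rewrite hS //; congr addn.
      case: (ltnP c0 (N + m0 * p)) => H2; last by rewrite ifF //; lia.
      by rewrite ifT; [congr (k p _); lia | lia].
    by case: (ltnP c0 (N + m0 * p)) => H3 //; lia.
  by rewrite natrD mulrDr opprD addrCA subrr addr0.
by rewrite tele // /shift; case: ifP => _; rewrite ?kl mulr0.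
Qed.

(** * Dimensions of spaces of maps *)

Section Dimension.
Variables (K : fieldType) (l : nat).
Local Notation S := {mpoly K[l]}.
Local Notation maps p := (('I_p -> S) -> S).

Definition lincomb p n (c : 'I_n -> K) (v : 'I_n -> maps p) : maps p :=
  fun f => \sum_(i < n) c i *: v i f.

Definition lincomb_closed p (P : maps p -> Prop) :=
  forall n (c : 'I_n -> K) v, (forall i, P (v i)) -> P (lincomb c v).

(** [is_dim] forbids independent families of size N + 1 only; passing to subfamilies extends this to
    all larger sizes. *)
Lemma linindep_sub p a b (v : 'I_b -> maps p) :
  (a <= b)%N -> linindep v -> exists g : 'I_a -> 'I_b, linindep (v \o g).
Proof.
move=> le_ab indv; exists (widen_ord le_ab) => c c0 i.
pose c' (j : 'I_b) : K := \sum_(i < a | widen_ord le_ab i == j) c i.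
have wid_inj : injective (widen_ord le_ab) by move=> i1 i2 /(congr1 val) /= /val_inj.
have <- : c' (widen_ord le_ab i) = c i.
  by rewrite /c' (eq_bigl (pred1 i)) ?big_pred1_eq // => j; rewrite (inj_eq wid_inj).
apply: indv => f; rewrite -[RHS](c0 f).
rewrite [RHS](partition_big (widen_ord le_ab) predT) //=.
apply: eq_bigr => j _; rewrite scaler_suml.
by apply: eq_bigr => i' /eqP <-.
Qed.

Lemma is_dim_le p (P : maps p -> Prop) a b (v : 'I_a -> maps p) :
  (forall i, P (v i)) -> linindep v -> is_dim P b -> (a <= b)%N.
Proof.
move=> Pv indv [_ maxb]; rewrite leqNgt; apply/negP => lt_ba.
have [g indg] := linindep_sub lt_ba indv.
by apply: (maxb (v \o g)) => // i; apply: Pv.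
Qed.

Lemma is_dim_uniq p (P : maps p -> Prop) a b : is_dim P a -> is_dim P b -> a = b.
Proof.
move=> dimA dimB; apply/eqP; rewrite eqn_leq.
have [[v [Pv indv]] _] := dimA; have [[w [Pw indw]] _] := dimB.
by rewrite (is_dim_le Pv indv dimB) (is_dim_le Pw indw dimA).
Qed.

(** The bound for P also bounds Q. By excluded middle, either an independent family in Q attains the
    bound, or it drops by one. *)
Lemma is_dim_sub p (P Q : maps p -> Prop) N :
  (forall v, Q v -> P v) -> is_dim P N -> exists k, is_dim Q k.
Proof.
move=> QP [_ maxN].
have {maxN} : forall v : 'I_N.+1 -> maps p, (forall i, Q (v i)) -> ~ linindep v.
  by move=> v Qv; apply: maxN => i; apply: QP.
elim: N => [|N IHN] maxN.
  by exists 0%N; split=> //; exists (fun=> fun=> 0); split=> [[]//|c _ []].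
have [[v Qv]|nov] :=
  classic (exists v : 'I_N.+1 -> maps p, (forall i, Q (v i)) /\ linindep v).
  by exists N.+1; split=> //; exists v.
by apply: IHN => v Qv indv; apply: nov; exists v.
Qed.

Lemma is_dim_span p (P : maps p -> Prop) N : is_dim P N ->
  exists v : 'I_N -> maps p, [/\ forall i, P (v i), linindep v
    & forall w, P w -> exists c, w = lincomb c v].
Proof.
case=> [[v [Pv indv]] maxN]; exists v; split=> // w Pw.
(* The family is w followed by v. Were w outside the span, it would be independent, against the
   maximality of N. *)
pose u (i : 'I_N.+1) := oapp v w (unlift ord0 i).
have Pu i : P (u i) by rewrite /u; case: (unliftP ord0 i) => [j _|_] /=; [apply: Pv|].
have u0 : u ord0 = w by rewrite /u unlift_none.
have uS i : u (lift ord0 i) = v i by rewrite /u liftK.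
apply: NNPP => now; apply: (maxN u Pu) => c c0.
have c0E f : c ord0 *: w f + \sum_(i < N) c (lift ord0 i) *: v i f = 0.
  by rewrite -[RHS](c0 f) big_ord_recl u0; under eq_bigr => i _ do rewrite -uS.
have [z|nz] := eqVneq (c ord0) 0; last first.
  case: now; exists (fun i => - (c ord0)^-1 * c (lift ord0 i)).
  apply: functional_extensionality => f; have /eqP := c0E f.
  rewrite addr_eq0 => /eqP /(congr1 (fun x => (c ord0)^-1 *: x)).
  rewrite scalerA mulVf // scale1r => ->.
  rewrite scalerN scaler_sumr -sumrN.
  by apply: eq_bigr => i _; rewrite scalerA mulNr scaleNr.
have cS : forall i, c (lift ord0 i) = 0.
  by apply: indv => f; rewrite -[RHS](c0E f) z scale0r add0r.
by move=> i; case: (unliftP ord0 i) => [j|] ->.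
Qed.

Lemma span_is_dim p (P : maps p -> Prop) N (v : 'I_N -> maps p) :
  (forall i, P (v i)) -> linindep v ->
  (forall w, P w -> exists c, w = lincomb c v) -> is_dim P N.
Proof.
move=> Pv indv spanv; split; first by exists v.
move=> u Pu indu.
have /fin_all_exists[c cE] : forall i, exists c, u i = lincomb c v.
  by move=> i; apply: spanv.
(* N + 1 rows in K^N are dependent: a nonzero vector of the left kernel is a relation among the u
   i. *)
pose A := \matrix_(i < N.+1, j < N) c i j.
have : kermx A != 0.
  by rewrite -mxrank_eq0 mxrank_ker subn_eq0 -ltnNge ltnS rank_leq_col.
case/rowV0Pn => r /sub_kermxP rA0 /eqP[]; apply/rowP => i; rewrite mxE.
apply: (indu (r 0)) => f.
under eq_bigr => i' _ do rewrite cE /lincomb scaler_sumr.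
rewrite exchange_big big1 //= => j _.
under eq_bigr => i' _ do rewrite scalerA.
rewrite -scaler_suml; have /rowP/(_ j) := rA0; rewrite !mxE => rAj.
rewrite (eq_bigr (fun i' => r 0 i' * A i' j)) => [|i' _]; last by rewrite mxE.
by rewrite rAj scale0r.
Qed.

(** R is the direct sum of Z and phi(W). That z + phi w = 0 forces w = 0 gives both the injectivity
    of phi on W and the trivial intersection, so bases of Z and W combine to one of R. *)
Lemma is_dim_split p q (R Z : maps p -> Prop) (W : maps q -> Prop)
    (phi : maps q -> maps p) a b :
  is_dim Z a -> is_dim W b ->
  (forall z, Z z -> R z) -> (forall w, W w -> R (phi w)) ->
  lincomb_closed Z -> lincomb_closed W ->
  (forall n (c : 'I_n -> K) v, phi (lincomb c v) = lincomb c (phi \o v)) ->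
  (forall z w, Z z -> W w -> (forall f, z f + phi w f = 0) -> forall f, w f = 0) ->
  (forall r, R r -> exists z w, [/\ Z z, W w & forall f, r f = z f + phi w f]) ->
  is_dim R (a + b).
Proof.
move=> /is_dim_span[z [Zz indz spanz]] /is_dim_span[w [Ww indw spanw]].
move=> ZR WR Zlin Wlin phiL direct decomp.
pose v (i : 'I_(a + b)) := match split i with inl i => z i | inr j => phi (w j) end.
have vl i : v (lshift b i) = z i by rewrite /v (unsplitK (inl i)).
have vr i : v (rshift a i) = phi (w i) by rewrite /v (unsplitK (inr i)).
have vE c f : \sum_i c i *: v i f =
    lincomb (c \o lshift b) z f + phi (lincomb (c \o @rshift a b) w) f.
  rewrite big_split_ord phiL /lincomb /=; congr (_ + _).
    by apply: eq_bigr => i _; rewrite vl.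
  by apply: eq_bigr => i _; rewrite vr.
apply: (@span_is_dim _ _ _ v).
- by move=> i; rewrite /v; case: split => j; [apply: ZR | apply: WR].
- move=> c c0.
  have cr : forall j, c (rshift a j) = 0.
    apply: indw; apply: (direct (lincomb (c \o lshift b) z)).
    - exact: Zlin.
    - exact: Wlin.
    move=> f.
    by rewrite -[RHS](c0 f) vE.
  have cl : forall i, c (lshift b i) = 0.
    apply: indz => f; rewrite -[RHS](c0 f) vE [X in _ + X](_ : _ = 0) ?addr0 //.
    by rewrite phiL /lincomb big1 // => j _ /=; rewrite cr scale0r.
  by move=> i; rewrite -(splitK i); case: (split i) => j /=.
- move=> r /decomp[z0 [w0 [/spanz[c1 ->] /spanw[c2 ->] rE]]].
  exists (fun i => match split i with inl i => c1 i | inr j => c2 j end).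
  apply: functional_extensionality => f; rewrite rE /lincomb vE.
  congr (_ + phi _ f).
    by apply: eq_bigr => i _ /=; rewrite (unsplitK (inl i)).
  apply: functional_extensionality => g.
  by apply: eq_bigr => i _ /=; rewrite (unsplitK (inr i)).
Qed.

End Dimension.

(** * Linear forms *)

Section LinearForms.
Variables (K : fieldType) (l : nat).
Local Notation S := {mpoly K[l]}.

Lemma mcoeff_linform (a : 'I_l -> K) j : (linform a)@_U_(j) = a j.
Proof.
rewrite /linform raddf_sum (bigD1 j) //= big1 => [|i ne_ij].
  by rewrite mcoeffZ mcoeffXU eqxx mulr1 addr0.
by rewrite mcoeffZ mcoeffXU (negbTE ne_ij) mulr0.
Qed.

Lemma linform_neq0 (a : 'I_l -> K) j : a j != 0 -> linform a != 0.
Proof. by apply: contraNneq => a0; rewrite -mcoeff_linform a0 mcoeff0. Qed.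

Lemma linform_dhomog (a : 'I_l -> K) m : linform a ^+ m \is m.-homog.
Proof.
rewrite -[X in X.-homog]mul1n; apply: dhomogMn.
by apply: rpred_sum => i _; apply: rpredZ; rewrite dhomogX /= mdeg1.
Qed.

(* Substituting x_j - (linform a) / a_j for x_j is an endomorphism whose kernel is
   the ideal generated by linform a, which is therefore prime. *)
Lemma linform_dvd_cancel (a b : 'I_l -> K) j m (q g : S) :
  a j != 0 -> (forall c, ~ (forall i, b i = c * a i)) ->
  linform b ^+ m * q = linform a * g -> exists q', q = linform a * q'.
Proof.
move=> aj0 nprop E.
pose s := [tuple 'X_i - ((i == j)%:R / a j) *: linform a | i < l] : l.-tuple S.
have rhoX i : 'X_i \mPo s = 'X_i - ((i == j)%:R / a j) *: linform a.
  by rewrite comp_mpolyXU -tnth_nth tnth_mktuple.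
have rhoL c : linform c \mPo s = linform c - (c j / a j) *: linform a.
  rewrite {1}/linform raddf_sum /=.
  under eq_bigr => i _ do rewrite comp_mpolyZ rhoX scalerBr scalerA.
  rewrite sumrB -scaler_suml; congr (_ - _ *: _).
  rewrite (bigD1 j) //= big1 ?addr0 ?eqxx ?mul1r // => i /negbTE ->.
  by rewrite mul0r mulr0.
have rhoa : linform a \mPo s = 0 by rewrite rhoL divff // scale1r subrr.
have rhob : linform b \mPo s != 0.
  apply/eqP; rewrite rhoL => /eqP; rewrite subr_eq0 => /eqP bE.
  apply: (nprop (b j / a j)) => i.
  by rewrite -mcoeff_linform bE mcoeffZ mcoeff_linform.
(* The substitution is the identity modulo [linform a]: this holds on variables and passes to
   products and sums. Hence whatever it kills is divisible by [linform a]. *)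
have congr_rho (p : S) : exists r, p - (p \mPo s) = linform a * r.
  elim/mpolyind: p => [|c mm p _ _ [r Er]].
    by exists 0; rewrite comp_mpoly0 subrr mulr0.
  have mulI (p1 p2 : S) :
      (exists r, p1 - (p1 \mPo s) = linform a * r) ->
      (exists r, p2 - (p2 \mPo s) = linform a * r) ->
      exists r, p1 * p2 - (p1 * p2 \mPo s) = linform a * r.
    move=> [r1 E1] [r2 E2]; exists (r1 * p2 + (p1 \mPo s) * r2).
    rewrite rmorphM /= mulrDr mulrA -E1 mulrCA -E2; ring.
  have [r1 E1] : exists r, 'X_[mm] - ('X_[mm] \mPo s) = linform a * r.
    rewrite mpolyXE_id; apply: (big_ind (fun p : S => exists r, p - (p \mPo s) = linform a * r)).
    - by exists 0; rewrite comp_mpoly1 subrr mulr0.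
    - exact: mulI.
    move=> i _; elim: (mm i) => [|k IHk].
      by exists 0; rewrite expr0 comp_mpoly1 subrr mulr0.
    rewrite exprS; apply: mulI IHk; rewrite rhoX opprB addrCA subrr addr0.
    by exists ((i == j)%:R / a j)%:MP; rewrite [RHS]mulrC mul_mpolyC.
  exists (c *: r1 + r); rewrite mulrDr -scalerAr -E1 -Er.
  by rewrite comp_mpolyD comp_mpolyZ scalerBr addrACA opprD.
have [q' Eq'] := congr_rho q; exists q'; rewrite -Eq'.
have /eqP : (linform b \mPo s) ^+ m * (q \mPo s) = 0.
  by rewrite -rmorphXn -rmorphM E rmorphM /= rhoa mul0r.
by rewrite mulf_eq0 expf_eq0 (negbTE rhob) andbF /= => /eqP ->; rewrite subr0.
Qed.

Lemma linform_pow_dvd_cancel (a b : 'I_l -> K) j m m' (q g : S) :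
  a j != 0 -> (forall c, ~ (forall i, b i = c * a i)) ->
  linform b ^+ m' * q = linform a ^+ m * g -> exists q', q = linform a ^+ m * q'.
Proof.
move=> aj0 nprop; elim: m q => [|m IHm] q E; first by exists q; rewrite mul1r.
have [q1 Eq1] : exists q1, q = linform a * q1.
  apply: (linform_dvd_cancel aj0 nprop (m := m') (g := linform a ^+ m * g)).
  by rewrite mulrA -exprS.
have [q2 Eq2] : exists q2, q1 = linform a ^+ m * q2.
  apply: IHm; apply: (mulfI (linform_neq0 aj0)).
  by rewrite mulrCA -Eq1 E exprS mulrA.
by exists q2; rewrite Eq1 Eq2 exprS mulrA.
Qed.

(** Multiplication by f carries the degree e part of q to the degree c + e part of f q, so only the
    part with c + e = d can be nonzero. *)
Lemma dhomog_divl (f q : S) c d : f != 0 -> f \is c.-homog -> f * q \is d.-homog ->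
  ((c <= d)%N -> q \is (d - c).-homog) /\ ((d < c)%N -> q = 0).
Proof.
move=> f0 fa fqd.
have piM e : f * pihomog mdeg e q = pihomog mdeg (c + e) (f * q).
  have part := pihomog_partitionE (mf := mdeg) (leq_maxl (msize q) e.+1).
  have lt_e : (e < maxn (msize q) e.+1)%N by rewrite leq_maxr.
  rewrite {2}part [in RHS]mulr_sumr raddf_sum (bigD1 (Ordinal lt_e)) //= big1 ?addr0.
    by rewrite [RHS]pihomog_dE //; apply: dhomogM (pihomogP _ _ _).
  move=> i; rewrite -val_eqE /= => ne_i.
  by apply: (@pihomog_ne0 _ _ _ (c + i)); rewrite ?eqn_add2l //; apply: dhomogM (pihomogP _ _ _).
have pi0 e : (c + e)%N != d -> pihomog mdeg e q = 0.
  move=> ne_e; apply: (mulfI f0); rewrite mulr0 piM.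
  by apply: pihomog_ne0 fqd; rewrite eq_sym.
have part := pihomog_partitionE (mf := mdeg) (leqnn (msize q)).
rewrite part; split=> [le_cd|lt_dc].
  apply: rpred_sum => i _; have [Ei|ne_i] := eqVneq (c + i)%N d.
    by rewrite -Ei addKn pihomogP.
  by rewrite pi0 // rpred0.
by rewrite big1 // => i _; apply: pi0; rewrite gtn_eqF // ltn_addr.
Qed.

End LinearForms.

(** * Alternating multiderivations *)

Section Multiderivations.
Variables (K : fieldType) (l : nat).
Local Notation S := {mpoly K[l]}.
Local Notation maps p := (('I_p -> S) -> S).

Definition derivation (D : S -> S) : Prop :=
  (forall (a : K) g1 g2, D (a *: g1 + g2) = a *: D g1 + D g2) /\
  (forall g1 g2, D (g1 * g2) = g1 * D g2 + g2 * D g1).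

Lemma derivationD D : derivation D -> {morph D : x y / x + y}.
Proof. by move=> [linD _] x y; have := linD 1 x y; rewrite !scale1r. Qed.

Lemma derivation0 D : derivation D -> D 0 = 0.
Proof.
by move=> /derivationD/(_ 0 0)/eqP; rewrite addr0 -subr_eq subrr eq_sym => /eqP.
Qed.

Lemma derivationZ D a x : derivation D -> D (a *: x) = a *: D x.
Proof. by move=> dD; have [linD _] := dD; rewrite -[a *: x]addr0 linD derivation0 // addr0. Qed.

Lemma derivation_linform D (a : 'I_l -> K) : derivation D ->
  D (linform a) = \sum_i a i *: D 'X_i.
Proof.
move=> dD; rewrite /linform (big_morph D (derivationD dD) (derivation0 dD)).
by apply: eq_bigr => i _; rewrite derivationZ.
Qed.

Lemma derivation_mull a D : derivation D -> derivation (fun g => a * D g).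
Proof.
move=> [linD leibD]; split=> [c g1 g2|g1 g2]; first by rewrite linD mulrDr scalerAr.
by rewrite leibD mulrDr !(mulrCA a).
Qed.

Lemma derivation_mulr a D : derivation D -> derivation (fun g => D g * a).
Proof.
move=> [linD leibD]; split=> [c g1 g2|g1 g2]; first by rewrite linD mulrDl scalerAl.
by rewrite leibD mulrDl !mulrA.
Qed.

Lemma derivation_sum n (D : 'I_n -> S -> S) :
  (forall i, derivation (D i)) -> derivation (fun g => \sum_i D i g).
Proof.
move=> dD; split=> [c g1 g2|g1 g2].
  by rewrite scaler_sumr -big_split; apply: eq_bigr => i _; case: (dD i) => ->.
by rewrite !mulr_sumr -big_split; apply: eq_bigr => i _; case: (dD i) => _ ->.
Qed.

Lemma derivation_div a D : a != 0 -> derivation (fun g => a * D g) -> derivation D.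
Proof.
move=> a0 [linD leibD]; split=> [c g1 g2|g1 g2]; apply: (mulfI a0).
  by rewrite linD mulrDr scalerAr.
by rewrite leibD mulrDr !(mulrCA a).
Qed.

Lemma derivation_vanish D : derivation D -> (forall i, D 'X_i = 0) -> forall g, D g = 0.
Proof.
move=> dD DX; have [linD leibD] := dD.
have D1 : D 1 = 0.
  have /eqP := leibD 1 1.
  by rewrite !mul1r -subr_eq subrr eq_sym => /eqP.
elim/mpolyind => [|c m p _ _ IHp]; first exact: derivation0.
rewrite linD IHp addr0 mpolyXE_id (_ : D _ = 0) ?scaler0 //.
apply: (big_ind (fun p => D p = 0)) => // [p1 p2 E1 E2|i _].
  by rewrite leibD E1 E2 !mulr0 addr0.
by elim: (m i) => [|k IHk] //; rewrite exprS leibD DX IHk !mulr0 addr0.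
Qed.

Lemma multiderE p (th : maps p) :
  multider th <-> forall f i, derivation (fun g => th (upd f i g)).
Proof. by []. Qed.

Section Updates.
Variable p : nat.
Implicit Types (f : 'I_p -> S) (i j : 'I_p).

Lemma upd_id f i : upd f i (f i) = f.
Proof. by apply: functional_extensionality => j; rewrite /upd; case: eqP => [->|]. Qed.

Lemma updC f i j a b : i != j -> upd (upd f i a) j b = upd (upd f j b) i a.
Proof.
move=> ne_ij; apply: functional_extensionality => k; rewrite /upd.
by case: eqP => [->|//]; rewrite eq_sym (negbTE ne_ij).
Qed.

End Updates.

Lemma multider_vanish p (th : maps p) : multider th ->
  (forall ii, th (fun j => 'X_(ii j)) = 0) -> forall f, th f = 0.
Proof.
move=> dth thX.
(* Arguments are freed from variables one at a time: the first n are arbitrary, the others still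
   variables. *)
suff H n : forall f, (forall j : 'I_p, (n <= j)%N -> exists i, f j = 'X_i) -> th f = 0.
  by move=> f; apply: (H p) => j; rewrite leqNgt ltn_ord.
elim: n => [|n IHn] f fX.
  have /fin_all_exists[ii iiE] : forall j, exists i, f j = 'X_i by move=> j; apply: fX.
  by rewrite (functional_extensionality f _ iiE) thX.
have [lt_np|le_pn] := ltnP n p; last first.
  by apply: IHn => j le_nj; have := leq_trans le_pn le_nj; rewrite leqNgt ltn_ord.
pose i0 := Ordinal lt_np.
rewrite -(upd_id f i0); apply: (derivation_vanish (dth f i0)) => i.
apply: IHn => j; rewrite leq_eqVlt /upd; case: (j =P i0) => [_ _|ne_j].
  by exists i.
case/orP=> [/eqP Ej|/fX//]; by case: ne_j; apply: val_inj.
Qed.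

(** * Permuting the arguments of an alternating map *)

Section Alternation.
Variables (p : nat) (th : maps p).
Hypotheses (dth : multider th) (ath : alternating th).
Implicit Type f : 'I_p -> S.

(** Polarisation: expanding B (f i + f j) (f i + f j) = 0 leaves the two mixed terms, whose sum is
    0. *)
Lemma alternating_tperm f i j : i != j -> th (f \o tperm i j) = - th f.
Proof.
move=> ne_ij; pose B x y := th (upd (upd f i x) j y).
have Bxx x : B x x = 0.
  apply: (ath (i := i) (j := j)) => //; rewrite /upd eqxx (negbTE ne_ij) !eqxx //.
have BDr x : {morph B x : y z / y + z} by apply: derivationD (dth _ _).
have BDl y : {morph B^~ y : x z / x + z}.
  by move=> x z; rewrite /B !(updC _ _ _ ne_ij); apply: derivationD (dth _ _) _ _.
have -> : th f = B (f i) (f j) by rewrite /B !upd_id.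
have -> : th (f \o tperm i j) = B (f j) (f i).
  congr th; apply: functional_extensionality => k; rewrite /= /upd.
  by case: tpermP => [->|->|/eqP/negbTE-> /eqP/negbTE->]; rewrite ?eqxx ?(negbTE ne_ij).
have := Bxx (f i + f j).
by rewrite BDl !BDr !Bxx add0r addr0 addrC => /eqP; rewrite addr_eq0 => /eqP.
Qed.

Lemma alternating_perm (s : 'S_p) f : th (f \o s) = (-1) ^+ s * th f.
Proof.
case: (prod_tpermP s) => ts -> dts {s}.
elim: ts dts f => [_|t ts IHts /= /andP[dt dts]] f.
  rewrite big_nil odd_perm1 mul1r; congr th.
  by apply: functional_extensionality => k; rewrite /= perm1.
rewrite big_cons odd_mul_tperm signr_addb.
have -> : f \o (tperm t.1 t.2 * \prod_(t0 <- ts) tperm t0.1 t0.2)%g =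
    (f \o (\prod_(t0 <- ts) tperm t0.1 t0.2)%g) \o tperm t.1 t.2.
  by apply: functional_extensionality => k; rewrite /= permM.
by rewrite alternating_tperm // IHts // dt mulN1r mulNr.
Qed.

End Alternation.

(** Values on variables determine th, and among more than l variables two coincide. *)
Lemma alternating_large p (th : maps p) : multider th -> alternating th -> (l < p)%N ->
  forall f, th f = 0.
Proof.
move=> dth ath lt_lp; apply: multider_vanish => // ii.
have /injectivePn[i [j ne_ij Eij]] : ~~ injectiveb ii.
  by apply/injectiveP => /leq_card; rewrite !card_ord leqNgt lt_lp.
by apply: (ath _ i j) => //; rewrite Eij.
Qed.

Definition fcons p (a : S) (f : 'I_p -> S) : 'I_p.+1 -> S :=
  fun i => oapp f a (unlift ord0 i).

Lemma fcons0 p a (f : 'I_p -> S) : fcons a f ord0 = a.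
Proof. by rewrite /fcons unlift_none. Qed.

Lemma fconsS p a (f : 'I_p -> S) i : fcons a f (lift ord0 i) = f i.
Proof. by rewrite /fcons liftK. Qed.

Lemma fcons_eta p (f : 'I_p.+1 -> S) : fcons (f ord0) (f \o lift ord0) = f.
Proof.
apply: functional_extensionality => i.
by case: (unliftP ord0 i) => [j|] ->; rewrite (fconsS, fcons0).
Qed.

Lemma fcons_upd p a (f : 'I_p -> S) i g :
  fcons a (upd f i g) = upd (fcons a f) (lift ord0 i) g.
Proof.
apply: functional_extensionality => k; rewrite /upd.
case: (unliftP ord0 k) => [j|] ->; first by rewrite !fconsS (inj_eq lift_inj).
by rewrite !fcons0 (negbTE (neq_lift _ _)).
Qed.

(** * Exterior multiplication by a derivation *)

Section Wedge.
Variable th0 : maps 1.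
Local Notation D g := (th0 (fun=> g)).

(** The product th0 ^ eta, expanded along the argument given to th0; [f \o lift i] omits the i-th
    argument. *)
Definition wedge p (eta : maps p) : maps p.+1 :=
  fun f => \sum_(i < p.+1) (-1) ^+ i * D (f i) * eta (f \o lift i).

Lemma upd_lift p (f : 'I_p.+1 -> S) i g : upd f i g \o lift i = f \o lift i.
Proof.
apply: functional_extensionality => j.
by rewrite /= /upd eq_sym (negbTE (neq_lift _ _)).
Qed.

Lemma upd_lift_neq p (f : 'I_p.+1 -> S) k i g :
  upd f (lift k i) g \o lift k = upd (f \o lift k) i g.
Proof.
by apply: functional_extensionality => j; rewrite /= /upd (inj_eq lift_inj).
Qed.

Lemma multider1_derivation : multider th0 -> derivation (fun g => D g).
Proof.
move=> dth0; have -> : (fun g => D g) = (fun g => th0 (upd (fun=> 0) ord0 g)).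
  apply: functional_extensionality => g; congr th0.
  by apply: functional_extensionality => j; rewrite /upd (ord1 j).
exact: dth0.
Qed.

Lemma wedge_multider p (eta : maps p) :
  multider th0 -> multider eta -> multider (wedge eta).
Proof.
move=> dth0 deta; apply/multiderE => f i.
apply: derivation_sum => k.
case: (unliftP k i) => [i'|] ->.
  have -> : (fun g => (-1) ^+ k * D (upd f (lift k i') g k) * eta (upd f (lift k i') g \o lift k))
          = (fun g => (-1) ^+ k * D (f k) * eta (upd (f \o lift k) i' g)).
    apply: functional_extensionality => g; rewrite upd_lift_neq.
    by rewrite /upd (negbTE (neq_lift _ _)).
  exact/derivation_mull/deta.
have -> : (fun g => (-1) ^+ k * D (upd f k g k) * eta (upd f k g \o lift k))
        = (fun g => (-1) ^+ k * D g * eta (f \o lift k)).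
  by apply: functional_extensionality => g; rewrite upd_lift /upd eqxx.
exact/derivation_mulr/derivation_mull/multider1_derivation.
Qed.

(** Terms omitting neither i nor j vanish, as eta still sees a repeated argument. In the terms i and
    j the remaining arguments differ by a permutation s of sign (-1)^(i + j + 1), so these two
    cancel. *)
Lemma wedge_alternating p (eta : maps p) :
  multider eta -> alternating eta -> alternating (wedge eta).
Proof.
move=> deta aeta f i j ne_ij Efij.
rewrite /wedge (bigD1 i) // (bigD1 j) 1?eq_sym //= big1 ?addr0 => [|k /andP[ne_ki ne_kj]].
  pose s0 k := odflt k (unlift j (tperm i j (lift i k))).
  have s0K k : lift j (s0 k) = tperm i j (lift i k).
    have : j != tperm i j (lift i k).
      by rewrite -{1}(tpermL i j) (inj_eq perm_inj) neq_lift.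
    by rewrite /s0 => /unlift_some[k' -> Uk]; rewrite liftK.
  have s0_inj : injective s0.
    by move=> k1 k2 /(congr1 (lift j)); rewrite !s0K => /perm_inj/lift_inj.
  pose s := perm s0_inj.
  (* The parity of [lift_perm i j s] is i + j plus that of s, and a transposition is odd; this
     yields the sign of s. *)
  have Es : tperm i j = lift_perm i j s.
    apply/permP => k; case: (unliftP i k) => [k'|] ->.
      by rewrite lift_perm_lift (permE s0_inj) s0K.
    by rewrite lift_perm_id tpermL.
  have sgn_s : (s : bool) = ~~ (odd i (+) odd j).
    have := congr1 (@odd_perm _) Es; rewrite odd_tperm ne_ij odd_lift_perm.
    by case: (odd i); case: (odd j); case: (odd_perm s).
  have -> : f \o lift i = (f \o lift j) \o s.
    apply: functional_extensionality => k; rewrite /= (permE s0_inj) s0K.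
    by case: tpermP => [->|->|].
  rewrite alternating_perm // sgn_s Efij -(signr_odd _ i) -(signr_odd _ j).
  by case: (odd i); case: (odd j) => /=; ring.
have [i' Ei] := unlift_some ne_ki; have [j' Ej] := unlift_some ne_kj.
move=> _ _; rewrite (aeta _ i' j') ?mulr0 //=; last by rewrite -Ei -Ej.
by apply: contra_neq ne_ij => E; rewrite Ei Ej E.
Qed.

Lemma wedge_lincomb p n (c : 'I_n -> K) (v : 'I_n -> maps p) :
  wedge (lincomb c v) = lincomb c (fun i => wedge (v i)).
Proof.
apply: functional_extensionality => f; rewrite /wedge /lincomb.
under eq_bigr => i _ do rewrite mulr_sumr.
rewrite exchange_big; apply: eq_bigr => j _; rewrite scaler_sumr.
by apply: eq_bigr => i _; rewrite scalerAr.
Qed.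

(** Every term after the first keeps a as the first argument of eta, where eta vanishes. *)
Lemma wedge_fcons p (eta : maps p) a f :
  (forall (Hp : (0 < p)%N) g, g (Ordinal Hp) = a -> eta g = 0) ->
  wedge eta (fcons a f) = D a * eta f.
Proof.
move=> eta0; rewrite /wedge big_ord_recl fcons0 mul1r big1 ?addr0 => [|i _].
  congr (_ * eta _); apply: functional_extensionality => j; exact: fconsS.
rewrite (eta0 (leq_ltn_trans (leq0n _) (ltn_ord i))) ?mulr0 //=.
rewrite (_ : lift _ _ = ord0) ?fcons0 //; exact: val_inj.
Qed.

Lemma wedge_dhomog p (eta : maps p) d e :
  (forall i, D 'X_i \is d.-homog) -> homog_deg e eta -> homog_deg (d + e)%N (wedge eta).
Proof.
move=> hD heta ii; apply: rpred_sum => i _; apply: dhomogM; last exact: heta.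
by rewrite -signr_odd; case: (odd i); rewrite ?mul1r ?mulN1r ?rpredN; apply: hD.
Qed.

End Wedge.
End Multiderivations.

(** * The splitting by a good summand *)

Section Splitting.
Variables (K : fieldType) (l : nat).
Local Notation S := {mpoly K[l]}.
Local Notation maps p := (('I_p -> S) -> S).

Lemma lincomb_closedP p (P : maps p -> Prop) :
  P (fun=> 0) -> (forall a u v, P u -> P v -> P (fun f => a *: u f + v f)) ->
  lincomb_closed P.
Proof.
move=> P0 Plin; elim=> [|n IHn] c v Pv.
  rewrite (_ : lincomb c v = fun=> 0) //.
  by apply: functional_extensionality => f; rewrite /lincomb big_ord0.
rewrite (_ : lincomb c v = fun f => c ord0 *: v ord0 f +
    lincomb (c \o lift ord0) (v \o lift ord0) f).
  by apply: Plin => //; apply: IHn => i; apply: Pv.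
by apply: functional_extensionality => f; rewrite /lincomb big_ord_recl.
Qed.

Lemma is_dim_ext p (P Q : maps p -> Prop) N :
  (forall v, P v <-> Q v) -> is_dim P N -> is_dim Q N.
Proof.
move=> PQ [[v [Pv indv]] maxN]; split; first by exists v; split=> // i; apply/PQ.
by move=> w Qw; apply: maxN => i; apply/PQ.
Qed.

Lemma Ordinal0 p (Hp : (0 < p.+1)%N) : Ordinal Hp = ord0.
Proof. exact: val_inj. Qed.

(* For p = 0 the condition is vacuous, so Z_0 is all of D^0. *)
Definition contr0 (a : S) p (eta : maps p) : Prop :=
  forall (Hp : (0 < p)%N) g, g (Ordinal Hp) = a -> eta g = 0.

Variables (n : nat) (alpha : 'I_n -> 'I_l -> K) (m : 'I_n -> nat) (k0 : 'I_n).
Variable th0 : maps 1.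
Hypothesis multiarr : is_multiarr alpha m.
Hypothesis good : good_summand alpha m k0 th0.
Local Notation a0 := (linform (alpha k0)).
Local Notation m0 := (m k0).

Definition Dhom p d (th : maps p) : Prop := Dp alpha m th /\ homog_deg d th.
Definition Zhom p d (th : maps p) : Prop := Dhom d th /\ contr0 a0 th.

Lemma alpha_neq0 k : exists j, alpha k j != 0.
Proof. by have [H _] := multiarr. Qed.

Lemma a0_exp_neq0 : a0 ^+ m0 != 0.
Proof. by have [j /linform_neq0 aj0] := alpha_neq0 k0; rewrite expf_neq0. Qed.

Lemma Dhom_closed p d : lincomb_closed (@Dhom p d).
Proof.
apply: lincomb_closedP => [|a u v [[du [au Du]] hu] [[dv [av Dv]] hv]].
  split; last by move=> ii; apply: rpred0.
  split; first by move=> f i; split=> [c g1 g2|g1 g2]; rewrite ?scaler0 ?mulr0 addr0.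
  by split=> // Hp k f _; exists 0; rewrite mulr0.
split; last by move=> ii; apply: rpredD; [apply: rpredZ; apply: hu | apply: hv].
split.
  move=> f i; have [lu Lu] := du f i; have [lv Lv] := dv f i; split=> [c g1 g2|g1 g2].
    by rewrite lu lv !scalerDr !scalerA addrACA (mulrC a c).
  by rewrite Lu Lv scalerDr !scalerAr addrACA !mulrDr.
split; first by move=> f i j ne_ij E; rewrite (au f i j) // (av f i j) // scaler0 addr0.
move=> Hp k f E; have [q1 ->] := Du Hp k f E; have [q2 ->] := Dv Hp k f E.
by exists (a *: q1 + q2); rewrite mulrDr scalerAr.
Qed.

Lemma Zhom_closed p d : lincomb_closed (@Zhom p d).
Proof.
move=> k c v Zv; split; first by apply: Dhom_closed => i; case: (Zv i).
move=> Hp g E; rewrite /lincomb big1 // => i _.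
by case: (Zv i) => _ /(_ Hp g E) ->; rewrite scaler0.
Qed.

(** In each term the first argument alpha_H goes either to th0 or to the first place of eta, and
    either factor supplies alpha_H^m(H). *)
Lemma wedge_Dp p (eta : maps p) : Dp alpha m eta -> Dp alpha m (wedge th0 eta).
Proof.
have [[dth0 [_ Dth0]] _] := good.
move=> [deta [aeta Deta]]; split; first exact: wedge_multider.
split; first exact: wedge_alternating.
move=> Hp k f Ef.
rewrite Ordinal0 in Ef.
pose dvd (g : S) := exists q, g = linform (alpha k) ^+ m k * q.
apply: (big_ind dvd) => [|x y [qx ->] [qy ->]|i _]; first by exists 0; rewrite mulr0.
  by exists (qx + qy); rewrite mulrDr.
have dvdM x y : dvd x -> dvd (y * x) by move=> [q ->]; exists (y * q); rewrite mulrCA.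
case: (unliftP ord0 i) => [j|] ->; last first.
  by rewrite mulrAC; apply/dvdM/(Dth0 (ltn0Sn 0)).
apply/dvdM/(Deta (leq_ltn_trans (leq0n _) (ltn_ord j))).
by rewrite -Ef /=; congr f; apply: val_inj.
Qed.

Lemma wedge_Dhom p d (eta : maps p) : Dhom d eta -> Dhom (m0 + d)%N (wedge th0 eta).
Proof.
have [_ [h0 _]] := good.
by move=> [Deta heta]; split; [apply: wedge_Dp | apply: wedge_dhomog].
Qed.

Lemma wedge_fcons_a0 p (eta : maps p) f :
  contr0 a0 eta -> wedge th0 eta (fcons a0 f) = a0 ^+ m0 * eta f.
Proof. by have [_ [_ E0]] := good; move=> c0; rewrite wedge_fcons // E0. Qed.

(** The map eta is th(alpha0, ...) / alpha0^m0. It stays in D^p: at H0 it vanishes by alternation.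
    For another H, swapping the first two arguments of th shows that alpha_H^m(H) divides alpha0^m0
    eta, and alpha0^m0 cancels because the two forms are not proportional. *)
Lemma contraction p d (th : maps p.+1) : Dhom d th ->
  exists eta : maps p, [/\ forall f, th (fcons a0 f) = a0 ^+ m0 * eta f,
    Dp alpha m eta, contr0 a0 eta,
    ((m0 <= d)%N -> homog_deg (d - m0) eta) & ((d < m0)%N -> forall f, eta f = 0)].
Proof.
move=> [[dth [ath Dth]] hth].
have /functional_choice[eta etaE] : forall f, exists q, th (fcons a0 f) = a0 ^+ m0 * q.
  by move=> f; apply: (Dth (ltn0Sn p)); rewrite Ordinal0 fcons0.
have deta : multider eta.
  apply/multiderE => f i; apply: (derivation_div a0_exp_neq0).
  rewrite (_ : (fun _ => _) = (fun g => th (upd (fcons a0 f) (lift ord0 i) g))).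
    exact: dth.
  by apply: functional_extensionality => g; rewrite -etaE fcons_upd.
have c0 : contr0 a0 eta.
  move=> Hp g Eg; apply: (mulfI a0_exp_neq0); rewrite -etaE mulr0.
  by apply: (ath _ ord0 (lift ord0 (Ordinal Hp))); rewrite ?fcons0 ?fconsS.
have eta_hom ii : a0 ^+ m0 * eta (fun j => 'X_(ii j)) \is d.-homog.
  rewrite -etaE.
  (* [homog_deg] tests variables only, so alpha0 is expanded linearly in the first slot; the 0 there
     is a placeholder that [upd] overwrites. *)
  have -> : fcons a0 (fun j => 'X_(ii j)) = upd (fcons 0 (fun j => 'X_(ii j))) ord0 a0.
    apply: functional_extensionality => k; rewrite /upd.
    by case: (unliftP ord0 k) => [j|] ->; rewrite ?fcons0 ?fconsS.
  rewrite (derivation_linform _ (dth _ ord0)); apply: rpred_sum => i _; apply: rpredZ.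
  have -> : upd (fcons 0 (fun j => 'X_(ii j))) ord0 'X_i =
      (fun k => 'X_(oapp ii i (unlift ord0 k))) :> ('I_p.+1 -> S).
    apply: functional_extensionality => k; rewrite /upd.
    by case: (unliftP ord0 k) => [j|] ->; rewrite ?fconsS.
  exact: hth.
have divX ii := dhomog_divl a0_exp_neq0 (linform_dhomog _ _) (eta_hom ii).
exists eta; split=> //.
- split=> //; split.
    move=> f i j ne_ij Efij; apply: (mulfI a0_exp_neq0); rewrite -etaE mulr0.
    by apply: (ath _ (lift ord0 i) (lift ord0 j)); rewrite ?(inj_eq lift_inj) ?fconsS.
  move=> Hp k f; have [-> | ne_k Ef] := eqVneq k k0.
    by move=> Ef; exists 0; rewrite mulr0 (c0 Hp).
  have [j aj0] := alpha_neq0 k; have [_ [nprop _]] := multiarr.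
  have ne_0 : ord0 != lift ord0 (Ordinal Hp) := neq_lift _ _.
  have [g Eg] : exists g, - th (fcons a0 f) = linform (alpha k) ^+ m k * g.
    rewrite -(alternating_tperm dth ath _ ne_0); apply: (Dth (ltn0Sn p)).
    by rewrite /= Ordinal0 tpermL fconsS.
  apply: (linform_pow_dvd_cancel (b := alpha k0) (m' := m0) (g := - g) aj0).
    by apply: nprop; rewrite eq_sym.
  by rewrite -etaE mulrN -Eg opprK.
- by move=> le_md ii; apply: (divX ii).1.
- by move=> lt_dm; apply: multider_vanish => // ii; apply: (divX ii).2.
Qed.

Lemma Dhom_split p d a b : is_dim (@Zhom p.+1 d) a ->
  ((m0 <= d)%N -> is_dim (@Zhom p (d - m0)) b) ->
  is_dim (@Dhom p.+1 d) (a + if (m0 <= d)%N then b else 0).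
Proof.
move=> dimZ dimW; case: leqP => [le_md|lt_dm]; last first.
  (* Below degree m0 the contraction is 0 for degree reasons, so Z is everything. *)
  rewrite addn0; apply: is_dim_ext dimZ => v; split=> [[]//|Dv]; split=> //.
  move=> Hp g Eg; have [eta [etaE _ _ _ eta0]] := contraction Dv.
  rewrite Ordinal0 in Eg.
  by rewrite -[g]fcons_eta Eg etaE eta0 ?mulr0.
apply: (is_dim_split (phi := @wedge _ _ th0 p)) dimZ (dimW le_md) _ _ _ _ _ _ _.
- by move=> z [].
- by move=> w [/wedge_Dhom]; rewrite subnKC.
- exact: Zhom_closed.
- exact: Zhom_closed.
- exact: wedge_lincomb.
- move=> z w [_ z0] [_ w0] E f; apply: (mulfI a0_exp_neq0).
  rewrite mulr0 -(wedge_fcons_a0 _ w0) -[RHS](E (fcons a0 f)).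
  by rewrite (z0 (ltn0Sn p)) ?add0r // Ordinal0 fcons0.
move=> r Dr; have [w [wE Dw w0 hw _]] := contraction Dr.
have Dhw : Dhom (d - m0) w by split=> //; apply: hw.
(* Wedging the contraction w of r with th0 reproduces it, so the difference z has contraction 0. *)
pose z f := r f - wedge th0 w f.
exists z, w; split=> [||f]; [|by split|by rewrite /z subrK].
split.
  have := @Dhom_closed p.+1 d 2 (fun i => (-1) ^+ i)
    (fun i => if i == ord0 then r else wedge th0 w).
  rewrite (_ : lincomb _ _ = z); last first.
    apply: functional_extensionality => f.
    by rewrite /lincomb big_ord_recl big_ord1 /= expr1 scale1r scaleN1r.
  by apply=> i; case: eqP => // _; rewrite -(subnKC le_md); apply: wedge_Dhom.
move=> Hp g Eg.
rewrite Ordinal0 in Eg.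
by rewrite /z -[g]fcons_eta Eg wE wedge_fcons_a0 ?subrr.
Qed.

(* th0 ^ th has arity l + 1, hence is 0, and contracting it gives back th. *)
Lemma Zhom_top d N : is_dim (@Zhom l d) N -> N = 0%N.
Proof.
case=> [[v [Zv indv]] _]; case: N v Zv indv => // N v Zv indv.
have v0 f : v ord0 f = 0.
  have [[Dv _] c0] := Zv ord0; have [dw [aw _]] := wedge_Dp Dv.
  apply: (mulfI a0_exp_neq0); rewrite mulr0 -(wedge_fcons_a0 _ c0).
  exact: alternating_large.
have c0 f : \sum_(i < N.+1) (i == ord0)%:R *: v i f = 0.
  rewrite big1 // => i _; case: eqP => [->|_]; last by rewrite scale0r.
  by rewrite v0 scaler0.
by have /eqP := indv (fun i => (i == ord0)%:R) c0 ord0; rewrite eqxx oner_eq0.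
Qed.

End Splitting.

Theorem theorem3p8 (K : fieldType) (l n : nat) (alpha : 'I_n -> 'I_l -> K)
    (m : 'I_n -> nat) (k0 : 'I_n) (th0 : ('I_1 -> {mpoly K[l]}) -> {mpoly K[l]})
    (h : nat -> nat -> nat) (N : nat) :
  is_multiarr alpha m ->
  good_summand alpha m k0 th0 ->
  is_hilb alpha m h ->
  (forall d, (N <= d)%N -> psi_coef l h d = 0) ->
  ('X - ((m k0)%:R)%:P) %| chi_trunc l h N.
Proof.
move=> multiarr good hilb psi0.
(* k (p, d) is the dimension of Z_p in degree d, finite since Z_p lies in D^p. *)
have /functional_choice[k kE] : forall pd : nat * nat, exists k, (pd.1 <= l)%N ->
    is_dim (@Zhom K l n alpha m k0 pd.1 pd.2) k.
  move=> [p d] /=; have [le_pl|lt_lp] := leqP p l; last by exists 0%N.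
  have [|k dimk] := @is_dim_sub _ _ _ _ (@Zhom K l n alpha m k0 p d) _ _ (hilb p d le_pl).
    by move=> v [].
  by exists k.
rewrite dvdp_XsubCl; apply/rootP.
apply: (@chi_trunc_root _ _ _ _ (fun p d => k (p, d))) => // [d|p d lt_pl|d].
- apply: is_dim_uniq (hilb 0 d (leq0n l)) _.
  have dim0 : is_dim (Zhom alpha m k0 d) (k (0, d)) := kE (0, d) (leq0n l).
  apply: (is_dim_ext _ dim0) => v.
  by split=> [[]|Dv] //; split.
- apply: is_dim_uniq (hilb p.+1 d lt_pl) _.
  apply: (Dhom_split multiarr good (kE (p.+1, d) lt_pl)) => _.
  exact: (kE (p, (d - m k0)%N) (ltnW lt_pl)).
exact: (Zhom_top multiarr good (kE (l, d) (leqnn l))).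
Qed.
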